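(* Let $n \geq 2$ be any integer. Then the identities $x^n abc \approx abc$ and $xy \approx yx$ constitute an identity basis for the variety $\operatorname{var}\{N_3,\mathbb{Z}_n\}$ of semigroups.
   Context: All varieties are varieties of semigroups (one binary associative operation), and all identities are semigroup identities; associativity is always assumed. For semigroups $S,T$, $\operatorname{var}\{S,T\}$ denotes the variety generated by $S$ and $T$, i.e. the smallest class of semigroups containing $S$ and $T$ and closed under homomorphic images, subsemigroups, and arbitrary direct products. An identity basis for a variety $\mathbf{V}$ is a set of identities satisfied by $\mathbf{V}$ from which every identity satisfied by $\mathbf{V}$ can be deduced. $N_3=\langle a \mid a^3=0\rangle=\{a,a^2,0\}$ is the monogenic nilpotent semigroup of order $3$ (with zero $0$), and $\mathbb{Z}_n$ is the cyclic group of order $n$ regarded as a semigroup. *)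

(* Defs.v *)
From HB Require Import structures.
From mathcomp Require Import all_boot all_algebra all_fingroup.
From mathcomp Require Import boolp classical_sets.

Set Implicit Arguments.
Unset Strict Implicit.
Unset Printing Implicit Defensive.

Local Open Scope group_scope.

(* The free semigroup over the letters 0, 1, 2, ...; the pair (i, s) is the
   nonempty word i :: s. *)
Definition word := (nat * seq nat)%type.
HB.instance Definition _ := Choice.on word.

Definition word_mul (u v : word) : word := (u.1, u.2 ++ v.1 :: v.2).

Fact word_mulA : associative word_mul.
Proof. by move=> u v w; rewrite /word_mul /= -catA. Qed.

HB.instance Definition _ := isSemigroup.Build word word_mulA.

Definition letter (i : nat) : word := (i, [::]).

(* The morphism from the free semigroup to S extending f; for S := word it is
   substitution. *)
Definition eval (S : semigroupType) (f : nat -> S) (w : word) : S :=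
  foldl (fun s i => s * f i) (f w.1) w.2.

(* The pair (u, v) stands for the identity u ≈ v. *)
Definition identity := (word * word)%type.

Definition satisfies (S : semigroupType) (e : identity) : Prop :=
  forall f : nat -> S, eval f e.1 = eval f e.2.

(* Deduction in equational logic; associativity is built into words. *)
Inductive deducible (B : set identity) : word -> word -> Prop :=
| ded_axiom u v : B (u, v) -> deducible B u v
| ded_refl u : deducible B u u
| ded_sym u v : deducible B u v -> deducible B v u
| ded_trans u v w : deducible B u v -> deducible B v w -> deducible B u w
| ded_mul u u' v v' :
    deducible B u u' -> deducible B v v' -> deducible B (u * v) (u' * v')
| ded_subst (f : nat -> word) u v :
    deducible B u v -> deducible B (eval f u) (eval f v).

Definition semigroup_prod (I : Type) (S : I -> semigroupType) : Type :=
  forall i, S i.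

Section SemigroupProd.
Context (I : Type) (S : I -> semigroupType).

HB.instance Definition _ := gen_eqMixin (semigroup_prod S).
HB.instance Definition _ := gen_choiceMixin (semigroup_prod S).

Definition semigroup_prod_mul (p q : semigroup_prod S) : semigroup_prod S :=
  fun i => p i * q i.

Fact semigroup_prod_mulA : associative semigroup_prod_mul.
Proof. by move=> p q r; apply: functional_extensionality_dep => i; apply: mulgA. Qed.

HB.instance Definition _ :=
  isSemigroup.Build (semigroup_prod S) semigroup_prod_mulA.

End SemigroupProd.

(* The subsemigroup U of S is given by an embedding of U into S. The carrier of
   a semigroupType may be empty, whereas semigroups are nonempty: without
   [inhabited U] the empty semigroup would belong to every nonempty variety.
   Classes are plain predicates and not sets: universe constraints of the
   library forbid [set semigroupType]. *)
Definition is_variety (V : semigroupType -> Prop) : Prop :=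
  [/\ forall (S T : semigroupType) (f : {multiplicative S -> T}),
        (forall t, exists s, f s = t) -> V S -> V T,
      forall (S U : semigroupType) (f : {multiplicative U -> S}),
        inhabited U -> injective f -> V S -> V U
    & forall (I : Type) (S : I -> semigroupType),
        (forall i, V (S i)) -> V (semigroup_prod S)].

(* The smallest variety containing S and T. *)
Definition var (S T : semigroupType) (U : semigroupType) : Prop :=
  forall V, is_variety V -> V S -> V T -> V U.

Definition identity_basis (B : set identity) (V : semigroupType -> Prop) : Prop :=
  (forall e, B e -> forall S, V S -> satisfies S e) /\
  (forall e, (forall S, V S -> satisfies S e) -> deducible B e.1 e.2).

(* N_3 = <a | a^3 = 0>, with elements a, a^2 and 0. *)
Inductive N3 := N3_a | N3_aa | N3_0.

Definition N3_code (s : N3) : option bool :=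
  match s with N3_a => Some true | N3_aa => Some false | N3_0 => None end.

Definition N3_decode (o : option bool) : N3 :=
  match o with Some true => N3_a | Some false => N3_aa | None => N3_0 end.

Fact N3_codeK : cancel N3_code N3_decode.
Proof. by case. Qed.

HB.instance Definition _ := Equality.copy N3 (can_type N3_codeK).
HB.instance Definition _ := Choice.copy N3 (can_type N3_codeK).

Definition N3_mul (s t : N3) : N3 :=
  match s, t with N3_a, N3_a => N3_aa | _, _ => N3_0 end.

Fact N3_mulA : associative N3_mul.
Proof. by do 3!case. Qed.

HB.instance Definition _ := isSemigroup.Build N3 N3_mulA.

(* w to the power n, for n >= 1. *)
Definition word_pow (w : word) (n : nat) : word := iterop n *%g w w.

Definition id_xnabc (n : nat) : identity :=
  let x := letter 0 in let a := letter 1 in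
  let b := letter 2 in let c := letter 3 in
  (word_pow x n * a * b * c, a * b * c).

Definition id_comm : identity :=
  let x := letter 0 in let y := letter 1 in (x * y, y * x).

(* Main.v *)
Require Import Defs.
From mathcomp Require Import all_boot all_algebra all_fingroup.
From mathcomp Require Import boolp classical_sets.

(** An identity holds in N_3 and Z_n iff both sides have the same number of
    occurrences of each letter modulo n, and either both have length at least 3
    or they are permutations of each other. If u and v have length at least 3
    and the same letter counts modulo n, then every letter count of v^(n-1) u is
    divisible by n, so that v^(n-1) u is q^n up to commutativity for some word
    q; hence u ≈ v^n u ≈ (v^(n-1) u) v ≈ q^n v ≈ v. *)

Definition letters (w : word) : seq nat := w.1 :: w.2.

Section Eval.
Local Open Scope group_scope.

Lemma eval_mul (S : semigroupType) (f : nat -> S) (u v : word) :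
  eval f (u * v) = eval f u * eval f v.
Proof.
case: u v => [i s] [j t]; rewrite /eval /= foldl_cat /=.
move: (foldl _ (f i) s) => a; elim/last_ind: t => //= t k IHt.
by rewrite !foldl_rcons IHt mulgA.
Qed.

Lemma eval_pow (S : semigroupType) (f : nat -> S) (w : word) (n : nat) :
  eval f (word_pow w n) = iterop n *%g (eval f w) (eval f w).
Proof.
by rewrite /word_pow; case: n => //; elim=> //= n IHn; rewrite eval_mul IHn.
Qed.

Lemma eval_morph (S T : semigroupType) (h : {multiplicative S -> T})
    (f : nat -> S) (w : word) :
  eval (fun i => h (f i)) w = h (eval f w).
Proof.
case: w => i s; rewrite /eval /=.
by elim/last_ind: s => //= s j IHs; rewrite !foldl_rcons IHs gmulfM.
Qed.

Lemma eval_prod (I : Type) (S : I -> semigroupType)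
    (f : nat -> semigroup_prod S) (w : word) (k : I) :
  eval f w k = eval (fun i => f i k) w.
Proof.
case: w => i s; rewrite /eval /=.
by elim/last_ind: s => //= s j IHs; rewrite !foldl_rcons -IHs.
Qed.

(** At exponent 0, [iterop] returns its default, so [word_pow w 0] is [w] and the formula would
    fail. *)
Lemma count_letters_pow (w : word) (n i : nat) : (0 < n)%N ->
  count_mem i (letters (word_pow w n)) = (n * count_mem i (letters w))%N.
Proof.
case: n => // n _; rewrite /word_pow; elim: n => [|n IHn]; first by rewrite mul1n.
by rewrite mulSn -IHn -count_cat.
Qed.

End Eval.

Lemma is_variety_satisfies (e : identity) : is_variety (fun S => satisfies S e).
Proof.
split=> [S T h h_surj Se f | S U h _ h_inj Se f | I S Se f].
(* An assignment into a homomorphic image lifts along the surjection. *)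
- have [g hg] := choice (fun i => h_surj (f i)).
  have -> : f = fun i => h (g i) by apply/funext => i; rewrite hg.
  by rewrite !eval_morph Se.
- by apply: h_inj; rewrite -!eval_morph Se.
- by apply: functional_extensionality_dep => k; rewrite !eval_prod Se.
Qed.

(** The models of [e] form a variety, so once they include [S] and [T] they include all of
    [var S T]. *)
Lemma satisfies_var (S T : semigroupType) (e : identity) :
  (forall U, var S T U -> satisfies U e) <-> satisfies S e /\ satisfies T e.
Proof.
split=> [all_e | [Se Te] U].
  by split; apply: all_e => V _.
by move=> varU; exact: varU (is_variety_satisfies e) Se Te.
Qed.

Lemma N3_satisfies_xnabc (n : nat) : satisfies N3 (id_xnabc n).
Proof.
move=> f; rewrite !eval_mul; move: (eval f (word_pow _ _)) => p.
(* Products of three or more elements are [N3_0], whatever the value [p] of the power. *)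
by case: p; case: (eval f (letter 1)); case: (eval f (letter 2));
  case: (eval f (letter 3)).
Qed.

Lemma N3_satisfies_comm : satisfies N3 id_comm.
Proof.
move=> f; rewrite !eval_mul.
by case: (eval f (letter 0)); case: (eval f (letter 1)).
Qed.

Lemma iterop_expg (G : monoidType) (x : G) (n : nat) :
  0 < n -> iterop n *%g x x = (x ^+ n)%g.
Proof. by case: n => //; elim=> //= n IHn _; rewrite IHn. Qed.

Lemma Zp_satisfies_xnabc (n : nat) : 2 <= n -> satisfies 'Z_n (id_xnabc n).
Proof.
move=> n_ge2 f; rewrite !eval_mul eval_pow.
set x := eval f (letter 0).
rewrite iterop_expg ?(ltnW n_ge2) //.
have -> : (x ^+ n)%g = 1%g.
  rewrite Zp_expg; apply: val_inj => /=.
  (* The modulus built into ['Z_n] is [(Zp_trunc n).+2], which equals [n] because [2 <= n]. *)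
  by rewrite -[X in _ * X](Zp_cast n_ge2) modnMl.
by rewrite mul1g.
Qed.

Lemma Zp_satisfies_comm (n : nat) : satisfies 'Z_n id_comm.
Proof. by move=> f; rewrite !eval_mul; apply: Zp_mulgC. Qed.

(** The product of ['Z_n] is addition: each occurrence of [i] contributes 1 and every other letter
    the neutral element 0. *)
Lemma eval_Zp_count (n i : nat) (w : word) :
  eval (fun j => ((j == i)%:R)%R : 'Z_n) w = ((count_mem i (letters w))%:R)%R.
Proof.
case: w => j s; rewrite /letters /eval /=.
elim/last_ind: s => [|s k IHs] /=; first by rewrite addn0.
by rewrite foldl_rcons IHs -cats1 count_cat /= addn0 addnA [RHS]GRing.natrD.
Qed.

Lemma Zp_satisfies_count (n : nat) (u v : word) : 2 <= n ->
    satisfies 'Z_n (u, v) ->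
  forall i, count_mem i (letters u) = count_mem i (letters v) %[mod n].
Proof.
move=> n_ge2 uv i; have := uv (fun j => ((j == i)%:R)%R); rewrite !eval_Zp_count.
by move/(congr1 val); rewrite /= !val_Zp_nat.
Qed.

Lemma eval_N3_long (f : nat -> N3) (i j k : nat) (s : seq nat) :
  eval f (i, [:: j, k & s]) = N3_0.
Proof.
elim/last_ind: s => [|s l IHs].
  by rewrite /eval /=; case: (f i); case: (f j); case: (f k).
by move: IHs; rewrite /eval /= foldl_rcons => ->; case: (f l).
Qed.

Lemma N3_satisfies_cases (u v : word) : satisfies N3 (u, v) ->
  perm_eq (letters u) (letters v) \/
    (2 < size (letters u)) && (2 < size (letters v)).
Proof.
move=> uv.
(* This assignment separates the lengths 1, 2 and at least 3. *)
have uva := uv (fun=> N3_a).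
(* On a word of length at most 2, [h k] gives [N3_0] exactly when [k] occurs. Two words of the same
   length, 1 or 2, with the same set of letters are permutations of each other. *)
pose h (k l : nat) := if l == k then N3_0 else N3_a.
have uv0 k := uv (h k).
case: u v uva uv0 {uv} => [i [|j [|k s]]] [i' [|j' [|k' s']]] /=;
  rewrite ?eval_N3_long //; try by right.
- move=> _ /(_ i); rewrite /eval /h /= eqxx.
  by case: eqP => // -> _; left.
- move=> _ uv0; left; move: (uv0 i) (uv0 j) (uv0 i') (uv0 j').
  rewrite /eval /h /letters /= !eqxx.
  have swap : perm_eq [:: i; j] [:: j; i] by rewrite (perm_catC [:: i] [:: j]).
  have [<-|ne1] := eqVneq i' i.
    have [<-//|ne2] := eqVneq j' j.
    have [->|] := eqVneq j i'; rewrite ?eqxx ?(negbTE ne2) // => _.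
      by have [->|] := eqVneq j' i'.
  have [->|//] := eqVneq j' i.
  by have [->|] := eqVneq i' j.
Qed.

Section Deduction.
Variable B : set identity.
Hypothesis B_comm : B id_comm.

Lemma deducible_comm (u v : word) : deducible B (u * v)%g (v * u)%g.
Proof.
pose f i := if i == 0 then u else v.
exact: (ded_subst f (ded_axiom B_comm)).
Qed.

Lemma deducible_perm (u v : word) :
  perm_eq (letters u) (letters v) -> deducible B u v.
Proof.
move=> uv.
(* Permutations are generated by swaps of adjacent blocks. That induction runs over all lists, so
   [P] needs a value on the empty list, which is no word. *)
pose P s := if s is i :: s' then deducible B u (i, s') else True.
suff : P (letters v) by case: (v).
apply: (catCA_perm_ind (P := P)) uv _; last by case: (u) @P => i s /=; exact: ded_refl.
move=> [|i s1] [|j s2] s3 //; rewrite /P ?cats0 //= => ded_u.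
apply: (ded_trans ded_u).
have := deducible_comm (i, s1) (j, s2).
case: s3 ded_u => [|k s3] _; first by rewrite !cats0.
by move=> /ded_mul/(_ (ded_refl B (k, s3))); rewrite -!mulgA.
Qed.

Variable n : nat.
Hypothesis n_gt0 : 0 < n.
Hypothesis B_xnabc : B (id_xnabc n).

Lemma deducible_pow_mul (p w : word) : 2 < size (letters w) ->
  deducible B (word_pow p n * w)%g w.
Proof.
case: w => i [|j [|k s]] // _.
(* The letters 0 to 3 stand for x, a, b, c; c absorbs the whole tail of [w]. *)
pose f l := nth p [:: p; letter i; letter j; (k, s)] l.
have := ded_subst f (ded_axiom B_xnabc).
by rewrite !eval_mul eval_pow -!mulgA.
Qed.

End Deduction.

Lemma exists_seq_count (f : nat -> nat) (s : seq nat) :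
    (forall i, i \notin s -> f i = 0) ->
  exists t, forall i, count_mem i t = f i.
Proof.
(* Without [undup], a letter repeated in [s] would contribute its block several times. *)
move=> f0; exists (flatten [seq nseq (f j) j | j <- undup s]) => i.
transitivity ((i \in s) * f i); last first.
  by case: (boolP (i \in s)) => [_|/f0->]; rewrite ?mul1n ?muln0.
rewrite -mem_undup; elim: (undup s) (undup_uniq s) => //= j r IHr /andP[jr ur].
rewrite count_cat count_nseq IHr //= in_cons [i == j]eq_sym.
by have [<-|_] := eqVneq j i; rewrite ?(negbTE jr) ?addn0.
Qed.

Lemma perm_pow_mul (n : nat) (u v : word) : 0 < n ->
    (forall i, count_mem i (letters u) = count_mem i (letters v) %[mod n]) ->
  exists q,
    perm_eq (letters (word_pow v n * u)%g) (letters (word_pow q n * v)%g).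
Proof.
move=> n_gt0 uv.
(* These are the letter counts of v^(n-1) u; modulo [n] they agree with those of v^n, hence
   vanish. *)
pose c i := n.-1 * count_mem i (letters v) + count_mem i (letters u).
have n_dvd i : n %| c i.
  rewrite /dvdn /c -modnDmr uv modnDmr addnC -mulSn prednK //.
  by rewrite modnMr.
have [t tE] : exists t, forall i, count_mem i t = c i %/ n.
  apply: (@exists_seq_count _ (letters v ++ letters u)) => i.
  rewrite mem_cat negb_or => /andP[/count_memPn iv /count_memPn iu].
  by rewrite /c iv iu muln0 div0n.
have {}tE i : n * count_mem i t = c i by rewrite tE mulnC divnK.
(* An empty [t] would make [c] zero everywhere, but the first letter of [u] has a positive count. *)
case: t tE => [|k t] tE.
  have := tE u.1; rewrite /c /= muln0 eqxx addnCA.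
  by move/eqP.
exists (k, t); apply/allP => i _; apply/eqP.
have lM (a b : word) : letters (a * b)%g = letters a ++ letters b by [].
rewrite !lM !count_cat !count_letters_pow // tE /c.
by rewrite -{1}(prednK n_gt0) mulSn -addnA addnC.
Qed.

(* As a semigroup, 'Z_n carries addition modulo n. *)
Theorem propositionB11 (n : nat) (n_ge2 : 2 <= n) :
  identity_basis [set id_xnabc n; id_comm]%classic (var N3 'Z_n).
Proof.
have n_gt0 : 0 < n by apply: leq_trans n_ge2.
split=> [e Be | [u v]].
  apply/satisfies_var; case: Be => ->; split.
  - exact: N3_satisfies_xnabc.
  - exact: Zp_satisfies_xnabc.
  - exact: N3_satisfies_comm.
  - exact: Zp_satisfies_comm.
move=> /satisfies_var[/N3_satisfies_cases N3uv /(Zp_satisfies_count _ _ _ n_ge2) Zuv] /=.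
set B := [set _; _]%classic.
have Bcomm : B id_comm by right.
have Bx : B (id_xnabc n) by left.
case: N3uv => [|/andP[u_gt2 v_gt2]]; first exact: deducible_perm.
have [q /(deducible_perm _ Bcomm) uv] := perm_pow_mul _ _ _ n_gt0 Zuv.
apply: ded_trans (ded_trans uv _); last exact: deducible_pow_mul.
by apply: ded_sym; apply: deducible_pow_mul.
Qed.
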